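(* Let $k\ge 1$ and $q\ge 1$ be fixed natural numbers and let $f:\{0,1\}^{k+1}\to\{0,1\}$ be a non-degenerate boolean function. There is a constant $c>0$ depending only on $k$ and $q$ such that, for $n\le c\, d^k/\log_{(q)} d$ (where $d=d(n)$), any (randomized) privacy mechanism which, for every database $D\in\{0,1\}^{n\times(d+1)}$, releases $\Sigma_f(D)$ by adding $o(\sqrt n)$ noise to each entry (i.e. outputs $\mathbf y\in\mathbb R^{d^k}$ with $|y_J-\Sigma_f(D)_J|=o(\sqrt n)$ for every index $J$), or equivalently releases $\Sigma_f(D)/n$ by adding $o(1/\sqrt n)$ noise to each entry, is attribute non-private. The attack (adversary) achieving this violation runs in time $O(d^k n^2)$.
   Context: Every function $\{0,1\}^{m}\to\mathbb R$ has a unique representation as a multilinear polynomial over the reals. A function $f:\{0,1\}^{k+1}\to\{0,1\}$ is non-degenerate if its multilinear polynomial representation has degree exactly $k+1$. A database is $D=(U\,|\,\mathbf s)$ where $U=(\delta_{i,j})\in\{0,1\}^{n\times d}$ is public (non-sensitive) and $\mathbf s=(s_1,\dots,s_n)\in\{0,1\}^n$ is the sensitive column. For $J=(j_1,\dots,j_k)\in\{1,\dots,d\}^k$ (repeated entries allowed) let $F(D|_J)=\sum_{i=1}^n f(\delta_{i,j_1},\dots,\delta_{i,j_k},s_i)$, and let $\Sigma_f(D)\in\mathbb R^{d^k}$ be the vector $(F(D|_J))_{J\in\{1,\dots,d\}^k}$. Iterated logarithm: $\log_{(1)}t=\max(\log t,1)$ and $\log_{(q+1)}t=\log_{(1)}(\log_{(q)}t)$.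 A randomized mechanism $\mathcal M$ (taking databases $(U|\mathbf s)$ to outputs) allows $(\alpha,\beta)$ attribute reconstruction if there exist a setting $U$ of the public attributes and an algorithm $\mathcal A$ such that for every $\mathbf s\in\{0,1\}^n$, $\Pr_{\mathbf y\leftarrow\mathcal M((U|\mathbf s))}[d_H(\mathbf s,\mathcal A(U,\mathbf y))\le\alpha]\ge 1-\beta$, where $d_H$ is Hamming distance. A family of mechanisms (indexed by $n$, with $d=d(n)$) is attribute non-private if for an infinite sequence of $n$ it allows $(\alpha,\beta)$ attribute reconstruction with $\alpha=o(n)$ and $\beta=o(1)$. *)

(* Defs.v *)
From mathcomp Require Import all_boot all_order all_algebra.
From mathcomp Require Import all_classical all_reals all_analysis.
(* The notations of mpoly clash with those of analysis. *)
From mathcomp Require Import -(notations) mpoly.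

Set Implicit Arguments.
Unset Strict Implicit.
Unset Printing Implicit Defensive.

Import Order.TTheory GRing.Theory Num.Theory.
Import numFieldNormedType.Exports.

Local Open Scope classical_set_scope.
Local Open Scope ring_scope.

Definition multilinear (R : realType) (m : nat) (p : mpoly m R) : Prop :=
  forall mon : multinom m, mon \in msupp p ->
  forall i : 'I_m, (mon i <= 1)%N.

Definition represents (R : realType) (m : nat) (p : mpoly m R)
    (f : m.-tuple bool -> bool) : Prop :=
  forall x : m.-tuple bool,
    meval (fun i => (tnth x i)%:R) p = (f x)%:R.

(* [mmeasure mdeg p] is what the notation [msize p] abbreviates: degree + 1. *)
Definition nondegenerate_fun (R : realType) (m : nat) (f : m.-tuple bool -> bool) :
    Prop :=
  exists p : mpoly m R,
    [/\ multilinear p, represents p f & mmeasure mdeg p = m.+1].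

Definition log1 (R : realType) (t : R) : R := Num.max (ln t) 1.

(* [ilog q] is log_(q); it is only used for q >= 1. *)
Definition ilog (R : realType) (q : nat) (t : R) : R := iter q (@log1 R) t.

Definition database (n d : nat) : Type := ('M[bool]_(n, d) * n.-tuple bool)%type.

Definition rowJ (n d k : nat) (D : database n d) (J : k.-tuple 'I_d)
    (i : 'I_n) : k.+1.-tuple bool :=
  [tuple of rcons [tuple D.1 i (tnth J l) | l < k] (tnth D.2 i)].

Definition Sigma (R : realType) (n d k : nat) (f : k.+1.-tuple bool -> bool)
    (D : database n d) (J : k.-tuple 'I_d) : R :=
  \sum_(i < n) (f (rowJ D J i))%:R.

(* A randomized mechanism is a map of the database and of random coins; its
   output on D is the random vector [answer D], with values in R^(d^k). *)
Record mechanism (R : realType) (n d k : nat) := Mechanism {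
  coins_display : measure_display;
  coins : measurableType coins_display;
  coins_law : probability coins R;
  answer : database n d -> coins -> k.-tuple 'I_d -> R;
  measurable_answer : forall (D : database n d) (J : k.-tuple 'I_d),
    measurable_fun setT (fun w => answer D w J) }.

Definition releases_with_noise_o (R : realType) (k : nat) (d : nat -> nat)
    (M : forall n : nat, mechanism R n (d n) k)
    (target : forall n : nat, database n (d n) -> k.-tuple 'I_(d n) -> R)
    (rate : nat -> R) : Prop :=
  exists2 e : nat -> R, e =o_\oo rate &
    forall (n : nat) (D : database n (d n)),
      {ae coins_law (M n), forall w, forall J : k.-tuple 'I_(d n),
        `|answer D w J - target n D J| <= e n}.

Definition hamming (n : nat) (s t : n.-tuple bool) : nat :=
  #|[set i | tnth s i != tnth t i]%SET|.

Definition attack (R : realType) (n d k : nat) : Type :=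
  'M[bool]_(n, d) -> (k.-tuple 'I_d -> R) -> n.-tuple bool.

(* (alpha, beta) attribute reconstruction, with the algorithm A as witness. *)
Definition allows_reconstruction_by (R : realType) (n d k : nat)
    (A : attack R n d k) (M : mechanism R n d k) (alpha beta : R) : Prop :=
  exists U : 'M[bool]_(n, d), forall s : n.-tuple bool,
    let success :=
      [set w | (hamming s (A U (answer (U, s) w)))%:R <= alpha] in
    measurable success /\ ((1 - beta)%:E <= coins_law M success)%E.

Definition attribute_non_private_by (R : realType) (k : nat) (d : nat -> nat)
    (A : forall n : nat, attack R n (d n) k)
    (M : forall n : nat, mechanism R n (d n) k) : Prop :=
  exists alpha beta : nat -> R,
    [/\ alpha =o_\oo (fun n : nat => n%:R : R),
        beta =o_\oo (fun _ : nat => 1 : R) &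
        infinite_set
          [set n | allows_reconstruction_by (A n) (M n) (alpha n) (beta n)]].

(* Running time is counted on a real RAM, programmed in a structured language:
   natural-number registers, used for addressing, and a real memory divided in
   banks, each an array of reals. There is no conversion from reals to naturals
   and the only real constants are 0 and 1. Every arithmetic operation, memory
   access, constant and command has cost 1. *)
Inductive iexpr : Type :=
| IConst of nat
| IReg of nat
| IAdd of iexpr & iexpr
| ISub of iexpr & iexpr
| IMul of iexpr & iexpr.

Inductive rexpr : Type :=
| RZero
| ROne
| RGet of nat & iexpr
| RAdd of rexpr & rexpr
| RSub of rexpr & rexpr
| RMul of rexpr & rexpr
| RDiv of rexpr & rexpr.

Inductive test : Type :=
| ILt of iexpr & iexpr
| RLt of rexpr & rexpr.

Inductive program : Type :=
| Skip
| ISet of nat & iexpr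
| RSet of nat & iexpr & rexpr
| Seq of program & program
| If of test & program & program
| While of test & program.

Record state (R : realType) := State {
  ireg : nat -> nat;
  rmem : nat -> nat -> R }.

Fixpoint ieval (R : realType) (st : state R) (e : iexpr) : nat :=
  match e with
  | IConst m => m
  | IReg v => ireg st v
  | IAdd e1 e2 => (ieval st e1 + ieval st e2)%N
  | ISub e1 e2 => (ieval st e1 - ieval st e2)%N
  | IMul e1 e2 => (ieval st e1 * ieval st e2)%N
  end.

Fixpoint icost (e : iexpr) : nat :=
  match e with
  | IConst _ | IReg _ => 1%N
  | IAdd e1 e2 | ISub e1 e2 | IMul e1 e2 => (icost e1 + icost e2).+1
  end.

Fixpoint reval (R : realType) (st : state R) (e : rexpr) : R :=
  match e with
  | RZero => 0
  | ROne => 1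
  | RGet a i => rmem st a (ieval st i)
  | RAdd e1 e2 => reval st e1 + reval st e2
  | RSub e1 e2 => reval st e1 - reval st e2
  | RMul e1 e2 => reval st e1 * reval st e2
  | RDiv e1 e2 => reval st e1 / reval st e2
  end.

Fixpoint rcost (e : rexpr) : nat :=
  match e with
  | RZero | ROne => 1%N
  | RGet _ i => (icost i).+1
  | RAdd e1 e2 | RSub e1 e2 | RMul e1 e2 | RDiv e1 e2 =>
      (rcost e1 + rcost e2).+1
  end.

Definition teval (R : realType) (st : state R) (t : test) : bool :=
  match t with
  | ILt e1 e2 => (ieval st e1 < ieval st e2)%N
  | RLt e1 e2 => reval st e1 < reval st e2
  end.

Definition tcost (t : test) : nat :=
  match t with
  | ILt e1 e2 => (icost e1 + icost e2).+1
  | RLt e1 e2 => (rcost e1 + rcost e2).+1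
  end.

Definition set_reg (R : realType) (st : state R) (v m : nat) : state R :=
  State (fun v' => if v' == v then m else ireg st v') (rmem st).

Definition set_mem (R : realType) (st : state R) (a i : nat) (x : R) : state R :=
  State (ireg st)
    (fun a' i' => if (a' == a) && (i' == i) then x else rmem st a' i').

(* [exec p st t st']: from st, p halts in st' after t elementary steps. *)
Inductive exec (R : realType) :
    program -> state R -> nat -> state R -> Prop :=
| exec_skip st : exec Skip st 1 st
| exec_iset st v e :
    exec (ISet v e) st (icost e).+1 (set_reg st v (ieval st e))
| exec_rset st a i e :
    exec (RSet a i e) st (icost i + rcost e).+1
      (set_mem st a (ieval st i) (reval st e))
| exec_seq st st1 st2 p1 p2 t1 t2 :
    exec p1 st t1 st1 -> exec p2 st1 t2 st2 ->
    exec (Seq p1 p2) st (t1 + t2).+1 st2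
| exec_if_true st st1 b p1 p2 t :
    teval st b -> exec p1 st t st1 -> exec (If b p1 p2) st (tcost b + t).+1 st1
| exec_if_false st st1 b p1 p2 t :
    ~~ teval st b -> exec p2 st t st1 ->
    exec (If b p1 p2) st (tcost b + t).+1 st1
| exec_while_false st b p :
    ~~ teval st b -> exec (While b p) st (tcost b).+1 st
| exec_while_true st st1 st2 b p t1 t2 :
    teval st b -> exec p st t1 st1 -> exec (While b p) st1 t2 st2 ->
    exec (While b p) st (tcost b + t1 + t2).+1 st2.

(* Base-d value of J, i.e. its rank in the lexicographic order. *)
Definition tuple_code (d k : nat) (J : k.-tuple 'I_d) : nat :=
  foldl (fun a (j : 'I_d) => (a * d + j)%N) 0%N J.

(* Input: registers 0 and 1 hold n and d, bank 0 holds U in row-major order,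
   bank 1 holds y in lexicographic order; everything else is 0. Each sum has at
   most one term, as (i, j) |-> i * d + j and [tuple_code] are injective. *)
Definition initial_state (R : realType) (n d k : nat) (U : 'M[bool]_(n, d))
    (y : k.-tuple 'I_d -> R) : state R :=
  State
    (fun v => match v with 0 => n | 1 => d | _ => 0 end)%N
    (fun a m => match a with
      | 0 => \sum_(i < n) \sum_(j < d | (i * d + j)%N == m) (U i j)%:R
      | 1 => \sum_(J : k.-tuple 'I_d | tuple_code J == m) y J
      | _ => 0
      end).

(* Output: the n bits in cells 0, ..., n - 1 of bank 2. *)
Definition computes_within (R : realType) (p : program) (n d k : nat)
    (A : attack R n d k) (T : nat) : Prop :=
  forall (U : 'M[bool]_(n, d)) (y : k.-tuple 'I_d -> R),
    exists (t : nat) (st' : state R),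
      [/\ exec p (initial_state U y) t st', (t <= T)%N &
          forall i : 'I_n, rmem st' 2 i = (tnth (A U y) i)%:R].

Definition small_enough (R : realType) (k q : nat) (c : R) (n d : nat) : Prop :=
  n%:R <= c * (d ^ k)%:R / ilog q d%:R.

(* Main.v *)
Require Import Defs.
From mathcomp Require Import all_boot all_order all_algebra.
From mathcomp Require Import all_classical all_reals all_analysis.
From mathcomp Require Import -(notations) mpoly.
From mathcomp Require Import measurable_realfun ring lra zify.
Import Order.TTheory GRing.Theory Num.Theory.
Import numFieldNormedType.Exports.
Local Open Scope ring_scope.

(** The public columns may be chosen, so no random matrices are needed. Take
    [m] a power of two with [n <= m ^ k <= 2 ^ k * n] and [L = 2 m]; for
    [c = (4 k) ^ - k] the [d] columns contain [k] disjoint blocks of [L]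
    columns. Sylvester's construction gives [m] balanced, pairwise orthogonal
    sign vectors of length [L]. Label each row [i] by a different word
    [a_1 ... a_k] over [m] letters and let the restriction of row [i] to block
    [l] be the vector number [a_l]. For [J] with one column in each block put
    [w_i(J) = \prod_l (-1) ^ U_(i, j_l)]. The vectors [w_i] are orthogonal of
    squared norm [L ^ k], and, by balancedness,
    [\sum_J w_i(J) Sigma_f(J) = m ^ k A_(s_i)] where
    [A_s = \sum_x (-1) ^ |x| f(x, s)]. Non-degeneracy says [A_0 <> A_1], so
    [s_i] can be read off by comparing with the midpoint. If each answer is off
    by at most [e], Bessel's inequality bounds the total squared error of the
    [n] correlations by [L ^ (2 k) e ^ 2], hence all but
    [4 ^ (k + 1) e ^ 2 / (A_1 - A_0) ^ 2 = o(n)] bits are recovered. *)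

Set Implicit Arguments.
Unset Strict Implicit.
Unset Printing Implicit Defensive.

(** * Orthogonal sign vectors *)

Lemma big_tuple_rcons (R : zmodType) (T : finType) (k : nat)
    (F : k.+1.-tuple T -> R) :
  \sum_t F t = \sum_(b : T) \sum_(t : k.-tuple T) F [tuple of rcons t b].
Proof.
rewrite exchange_big /= pair_bigA /=.
pose h (p : k.-tuple T * T) : k.+1.-tuple T := [tuple of rcons p.1 p.2].
have h_inj : injective h.
  move=> [t b] [t' b'] /(congr1 val) /= /rcons_inj [] /val_inj -> ->.
  by [].
have h_bij : bijective h.
  by apply: inj_card_bij => //; rewrite card_prod !card_tuple expnSr.
by rewrite (reindex h) //=; apply: onW_bij.
Qed.

Lemma sum_prod_tuple (R : comNzRingType) (T : finType) (k : nat)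
    (F : nat -> T -> R) :
  \sum_(t : k.-tuple T) \prod_(l < k) F l (tnth t l) =
  \prod_(l < k) \sum_b F l b.
Proof.
elim: k => [|k IH].
  rewrite big_ord0 (bigD1 [tuple]) //= big_ord0 big1 ?addr0 //.
  by move=> t /eqP []; rewrite [t]tuple0.
rewrite big_tuple_rcons big_ord_recr /= -IH mulr_sumr; apply: eq_bigr => b _.
rewrite mulr_suml; apply: eq_bigr => t _.
rewrite big_ord_recr /=; congr (_ * _).
  apply: eq_bigr => i _; congr (F _ _).
  by rewrite !(tnth_nth b) /= nth_rcons size_tuple ltn_ord.
by rewrite (tnth_nth b) /= nth_rcons size_tuple ltnn eqxx.
Qed.

Section Hadamard.
Variable R : realType.
Implicit Types (a b : nat) (x : bool).

Definition sg x : R := (-1) ^+ x.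

Lemma sgD x y : sg (x (+) y) = sg x * sg y.
Proof. by rewrite /sg signr_addb. Qed.

Lemma sg_sqr x : sg x * sg x = 1.
Proof. by rewrite -sgD addbb. Qed.

Lemma sgE x : sg x = 1 - 2 * x%:R.
Proof. by case: x; rewrite /sg /= ?expr0 ?expr1; lra. Qed.

Lemma big_ord_double m (F : nat -> R) :
  \sum_(b < m + m) F b = \sum_(b < m) (F b + F (m + b)%N).
Proof. by rewrite big_split_ord /= big_split. Qed.

(* Sylvester's doubling construction. *)
Lemma hadamard_exists r :
  exists h : nat -> nat -> bool, forall a a' : nat, (a < 2 ^ r)%N -> (a' < 2 ^ r)%N ->
    \sum_(b < 2 ^ r) sg (h a b) * sg (h a' b) = (2 ^ r)%:R * (a == a')%:R.
Proof.
elim: r => [|r [h Hh]].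
  exists (fun _ _ => false) => a a'; rewrite expn0 !ltnS !leqn0 => /eqP -> /eqP ->.
  by rewrite big_ord1 !sg_sqr.
pose m := (2 ^ r)%N.
have m_gt0 : (0 < m)%N by rewrite expn_gt0.
pose h' a b := h (a %% m)%N (b %% m)%N (+) ((m <= a) && (m <= b))%N.
exists h' => a a'; rewrite expnS mul2n -addnn -/m => lt_a lt_a'.
rewrite (big_ord_double m (fun b => sg (h' a b) * sg (h' a' b))).
have -> : \sum_(b < m) (sg (h' a b) * sg (h' a' b) +
                        sg (h' a (m + b)%N) * sg (h' a' (m + b)%N))
  = (1 + sg (m <= a)%N * sg (m <= a')%N) *
    \sum_(b < m) sg (h (a %% m)%N b) * sg (h (a' %% m)%N b).
  rewrite mulr_sumr; apply: eq_bigr => b _.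
  rewrite /h' modnDl (modn_small (ltn_ord b)) [(m <= b)%N]leqNgt ltn_ord leq_addr !andbT !andbF !addbF.
  by rewrite !sgD; ring.
rewrite Hh ?ltn_mod // -/m.
have divm (x : nat) : (x < m + m)%N -> x = ((m <= x) * m + x %% m)%N.
  move=> lt_x; rewrite {1}(divn_eq x m); congr (_ * _ + _)%N.
  case: leqP => [le_mx|]; last by move/divn_small.
  have -> : x = (1 * m + (x - m))%N by rewrite mul1n subnKC.
  by rewrite divnMDl // divn_small // ltn_subLR.
have -> : (a == a') = ((m <= a)%N == (m <= a')%N) && (a %% m == a' %% m)%N.
  apply/eqP/andP => [->//|[/eqP e1 /eqP e2]].
  by rewrite (divm a) // (divm a') // e1 e2.
by case: (m <= a)%N; case: (m <= a')%N; case: eqP => _; rewrite /sg /= natrD;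
  ring.
Qed.

Lemma balanced_hadamard_exists r :
  exists h : nat -> nat -> bool,
    (forall a, (a < 2 ^ r)%N -> \sum_(b < 2 ^ r + 2 ^ r) sg (h a b) = 0) /\
    forall a a' : nat, (a < 2 ^ r)%N -> (a' < 2 ^ r)%N ->
    \sum_(b < 2 ^ r + 2 ^ r) sg (h a b) * sg (h a' b) =
      2 * (2 ^ r)%:R * (a == a')%:R.
Proof.
have [h Hh] := hadamard_exists r; set m := (2 ^ r)%N in Hh *.
pose h' a b := h a (b %% m)%N (+) (m <= b)%N.
exists h'; split=> [a lt_a|a a' lt_a lt_a'].
  rewrite (big_ord_double m (fun b => sg (h' a b))) big1 // => b _.
  by rewrite /h' modnDl (modn_small (ltn_ord b)) [(m <= b)%N]leqNgt ltn_ord leq_addr !sgD /sg /=; ring.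
rewrite (big_ord_double m (fun b => sg (h' a b) * sg (h' a' b))).
rewrite -mulrA -Hh // mulr_sumr; apply: eq_bigr => b _.
by rewrite /h' modnDl (modn_small (ltn_ord b)) [(m <= b)%N]leqNgt ltn_ord leq_addr !sgD /sg /=; ring.
Qed.

Lemma bessel (I T : finType) (W : I -> T -> R) (P : R) (eta : T -> R) :
  0 < P ->
  (forall i i', \sum_t W i t * W i' t = P * (i == i')%:R) ->
  \sum_i (\sum_t W i t * eta t) ^+ 2 <= P * \sum_t eta t ^+ 2.
Proof.
move=> P_gt0 orthoW; pose c i := \sum_t W i t * eta t.
have : 0 <= \sum_t (P * eta t - \sum_i c i * W i t) ^+ 2.
  by apply: sumr_ge0 => t _; apply: sqr_ge0.
have -> : \sum_t (P * eta t - \sum_i c i * W i t) ^+ 2 =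
   P * (P * \sum_t eta t ^+ 2 - \sum_i c i ^+ 2).
  transitivity (P ^+ 2 * \sum_t eta t ^+ 2
     - 2 * P * \sum_t \sum_i c i * (W i t * eta t)
     + \sum_t \sum_i \sum_i' c i * c i' * (W i t * W i' t)).
    rewrite !mulr_sumr -sumrB -big_split /=; apply: eq_bigr => t _.
    rewrite sqrrB -mulrnAr !expr2.
    have -> : (\sum_i c i * W i t) * (\sum_i c i * W i t) =
       \sum_i \sum_i' c i * c i' * (W i t * W i' t).
      rewrite mulr_suml; apply: eq_bigr => i _; rewrite mulr_sumr.
      by apply: eq_bigr => i' _; ring.
    have -> : \sum_i c i * (W i t * eta t) = eta t * \sum_i c i * W i t.
      by rewrite mulr_sumr; apply: eq_bigr => i _; ring.
    by ring.
  rewrite exchange_big /=.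
  have -> : \sum_i \sum_t c i * (W i t * eta t) = \sum_i c i ^+ 2.
    by apply: eq_bigr => i _; rewrite -mulr_sumr expr2.
  rewrite exchange_big /=.
  have -> : \sum_i \sum_t \sum_i' c i * c i' * (W i t * W i' t) =
     P * \sum_i c i ^+ 2.
    rewrite mulr_sumr; apply: eq_bigr => i _; rewrite exchange_big /=.
    rewrite (bigD1 i) //= [X in _ + X]big1 ?addr0 => [|i' ne_i'].
      by rewrite -mulr_sumr orthoW eqxx mulr1; ring.
    by rewrite -mulr_sumr orthoW eq_sym (negPf ne_i') !mulr0.
  by ring.
by rewrite pmulr_rge0 // subr_ge0.
Qed.

End Hadamard.

(** * Non-degenerate functions *)

Lemma mdeg_full (m : nat) (mon : multinom m) :
  (forall i, (mon i <= 1)%N) -> mdeg mon = m -> forall i, mon i = 1%N.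
Proof.
move=> le1 degm i; apply/eqP; rewrite eqn_leq le1 lt0n /=; apply/negP => /eqP mon0.
have : (mdeg mon < m)%N; last by rewrite degm ltnn.
rewrite mdegE (bigD1 i) //= mon0 add0n.
rewrite -[X in (_ < X)%N](card_ord m) -sum1_card [X in (_ < X)%N](bigD1 i) //=.
by rewrite add1n ltnS; apply: leq_sum.
Qed.

Lemma signed_sum_neq0 (R : realType) (m : nat) (f : m.-tuple bool -> bool) :
  nondegenerate_fun R f ->
  \sum_(x : m.-tuple bool) (\prod_(l < m) sg R (tnth x l)) * (f x)%:R != 0.
Proof.
move=> [p [multp repp sizep]].
have -> : \sum_(x : m.-tuple bool) (\prod_(l < m) sg R (tnth x l)) * (f x)%:R =
   \sum_(mon <- msupp p) mcoeff mon p *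
     \prod_(l < m) \sum_(b : bool) (sg R b * b%:R ^+ nth 0%N mon l).
  under eq_bigr => x _ do rewrite -repp mevalE mulr_sumr.
  rewrite exchange_big /=; apply: eq_bigr => mon _.
  rewrite -(sum_prod_tuple m (fun l (b : bool) => sg R b * b%:R ^+ nth 0%N mon l)).
  rewrite mulr_sumr; apply: eq_bigr => x _.
  rewrite big_split /= mulrCA; congr (_ * (_ * _)).
  by apply: eq_bigr => l _; rewrite /fun_of_multinom (tnth_nth 0%N).
have p_neq0 : p != 0 by apply/eqP => p0; rewrite p0 mmeasure0 in sizep.
have lead_supp := mlead_supp p_neq0.
have lead1 : forall i, mlead p i = 1%N.
  apply: mdeg_full; first exact: multp.
  by apply: succn_inj; rewrite mlead_deg.
rewrite (bigD1_seq _ lead_supp (msupp_uniq p)) /= [X in _ + X]big1_seq => [|mon /andP[ne_mon in_mon]].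
  rewrite addr0 mulf_neq0 //; first by rewrite -mcoeff_msupp.
  apply/prodf_neq0 => l _; rewrite big_bool /=.
  have -> : nth 0%N (mlead p) l = 1%N by rewrite -(lead1 l) /fun_of_multinom (tnth_nth 0%N).
  by rewrite /sg /= !expr1 mulr0 addr0 mulr1 oppr_eq0 oner_eq0.
have [l mon0] : exists l, mon l = 0%N.
  have [//|none] := pselect (exists l, mon l = 0%N).
  case/eqP: ne_mon; apply/mnmP => l; rewrite lead1.
  apply/eqP; rewrite eqn_leq multp //= lt0n; apply/eqP => mon0.
  by apply: none; exists l.
rewrite (bigD1 l) //= big_bool /=.
have -> : nth 0%N mon l = 0%N by move: mon0; rewrite /fun_of_multinom (tnth_nth 0%N).
by rewrite /sg /= !expr0 expr1 !mulr1 addNr mul0r mulr0.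
Qed.

Definition signed_slice (R : realType) (k : nat) (f : k.+1.-tuple bool -> bool)
    (s : bool) : R :=
  \sum_(x : k.-tuple bool)
    (\prod_(l < k) sg R (tnth x l)) * (f [tuple of rcons x s])%:R.

Lemma signed_slice_neq (R : realType) (k : nat) (f : k.+1.-tuple bool -> bool) :
  nondegenerate_fun R f -> signed_slice R f true - signed_slice R f false != 0.
Proof.
move/signed_sum_neq0; rewrite big_tuple_rcons big_bool /= => neq0.
have sliceE s : \sum_(x : k.-tuple bool)
    (\prod_(l < k.+1) sg R (tnth [tuple of rcons x s] l)) *
      (f [tuple of rcons x s])%:R = sg R s * signed_slice R f s.
  rewrite mulr_sumr; apply: eq_bigr => x _; rewrite big_ord_recr /=.
  rewrite mulrA [sg R s * _]mulrC; congr (_ * _ * _).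
    apply: eq_bigr => l _; congr (sg R _).
    by rewrite !(tnth_nth s) /= nth_rcons size_tuple ltn_ord.
  by rewrite (tnth_nth s) /= nth_rcons size_tuple ltnn eqxx.
move: neq0; rewrite !sliceE /sg expr1 expr0 mulN1r mul1r addrC.
by rewrite -oppr_eq0 opprB.
Qed.

(** * Decoding product codes *)

Lemma digits_exist (n m k : nat) : (n <= m ^ k)%N ->
  exists dig : 'I_n -> nat -> nat,
    (forall i l, (l < k)%N -> (dig i l < m)%N) /\
    (forall i i', (forall l : 'I_k, dig i l = dig i' l) -> i = i').
Proof.
move=> le_n; have le_n' : (n <= #|{: k.-tuple 'I_m}|)%N by rewrite card_tuple card_ord.
pose a (i : 'I_n) : k.-tuple 'I_m := enum_val (widen_ord le_n' i).
have nthE i (l : 'I_k) : nth 0%N [seq val x | x <- a i] l = tnth (a i) l.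
  have x0 := tnth (a i) l.
  by rewrite (nth_map x0) ?size_tuple // (tnth_nth x0).
exists (fun i => nth 0%N [seq val x | x <- a i]); split=> [i l lt_l|i i' eq_dig].
  by rewrite (nthE i (Ordinal lt_l)).
have eq_a : a i = a i'.
  by apply: eq_from_tnth => l; apply: val_inj; rewrite /= -!nthE eq_dig.
have /(congr1 val) /= := enum_val_inj eq_a; exact: val_inj.
Qed.

Lemma prod_bool (R : realType) (k : nat) (P : pred 'I_k) :
  \prod_(l < k) (P l)%:R = [forall l, P l]%:R :> R.
Proof.
case: (boolP [forall l, P l]) => [/forallP allP|/forallPn [l nPl]].
  by rewrite big1 // => l _; rewrite allP.
by rewrite (bigD1 l) //= (negPf nPl) mul0r.
Qed.

Section ProductCode.
Variables (R : realType) (k n m : nat) (h : nat -> nat -> bool).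
Variable dig : 'I_n -> nat -> nat.
Hypothesis m_gt0 : (0 < m)%N.
Hypothesis balanced : forall a, (a < m)%N -> \sum_(b < m + m) sg R (h a b) = 0.
Hypothesis ortho : forall a a', (a < m)%N -> (a' < m)%N ->
  \sum_(b < m + m) sg R (h a b) * sg R (h a' b) = 2 * m%:R * (a == a')%:R.
Hypothesis dig_lt : forall i l, (l < k)%N -> (dig i l < m)%N.
Hypothesis dig_inj :
  forall i i', (forall l : 'I_k, dig i l = dig i' l) -> i = i'.

Let T := k.-tuple 'I_(m + m).

Definition weight (i : 'I_n) (t : T) : R :=
  \prod_(l < k) sg R (h (dig i l) (tnth t l)).

Definition code_row (i : 'I_n) (t : T) : k.-tuple bool :=
  [tuple h (dig i l) (tnth t l) | l < k].

Lemma prod_dig_eq i i' :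
  \prod_(l < k) (dig i l == dig i' l)%:R = (i == i')%:R :> R.
Proof.
rewrite prod_bool; congr (nat_of_bool _)%:R.
apply/forallP/eqP => [eq_dig|->//].
by apply: dig_inj => l; apply/eqP.
Qed.

Lemma weight_ortho i i' :
  \sum_t weight i t * weight i' t = (2 * m%:R) ^+ k * (i == i')%:R.
Proof.
under eq_bigr => t _ do rewrite /weight -big_split /=.
rewrite (sum_prod_tuple k (fun l (b : 'I_(m + m)) =>
  sg R (h (dig i l) b) * sg R (h (dig i' l) b))).
under eq_bigr => l _ do rewrite ortho ?dig_lt //.
by rewrite big_split /= prod_dig_eq prodr_const card_ord.
Qed.

Lemma correlation i i' l x : (l < k)%N ->
  \sum_(b < m + m) sg R (h (dig i l) b) * (h (dig i' l) b == x)%:R =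
  m%:R * (dig i l == dig i' l)%:R * sg R x.
Proof.
move=> lt_l.
transitivity (2^-1 * (\sum_(b < m + m) sg R (h (dig i l) b) +
  sg R x * \sum_(b < m + m) sg R (h (dig i l) b) * sg R (h (dig i' l) b))).
  rewrite mulr_sumr -big_split mulr_sumr; apply: eq_bigr => b _ /=.
  by case: (h _ _); case: (h _ _); case: x; rewrite /sg /=; field.
by rewrite balanced ?ortho ?dig_lt //; field.
Qed.

Lemma weight_row (f : k.+1.-tuple bool -> bool) i i' (s : bool) :
  \sum_t weight i t * (f [tuple of rcons (code_row i' t) s])%:R =
  m%:R ^+ k * (i == i')%:R * signed_slice R f s.
Proof.
transitivity (\sum_(t : k.-tuple 'I_(m + m)) \sum_(x : k.-tuple bool) (f [tuple of rcons x s])%:R *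
   \prod_(l < k) (sg R (h (dig i l) (tnth t l)) *
      (h (dig i' l) (tnth t l) == nth false x l)%:R)).
  apply: eq_bigr => t _; rewrite (bigD1 (code_row i' t)) //= [X in _ + X]big1 ?addr0.
    rewrite mulrC; congr (_ * _); apply: eq_bigr => l _.
    have -> : nth false (code_row i' t) l = h (dig i' l) (tnth t l).
      by rewrite -tnth_nth tnth_mktuple.
    by rewrite eqxx mulr1.
  move=> x ne_x; rewrite big_split /= prod_bool.
  case: (boolP [forall l, _]) => [/forallP eqx|_]; last by rewrite !mulr0.
  case/eqP: ne_x; apply: eq_from_tnth => l.
  by rewrite tnth_mktuple (tnth_nth false); apply/esym/eqP.
rewrite exchange_big /= /signed_slice mulr_sumr; apply: eq_bigr => x _.
rewrite -mulr_sumr.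
rewrite (sum_prod_tuple k (fun l (b : 'I_(m + m)) => sg R (h (dig i l) b) *
   (h (dig i' l) b == nth false x l)%:R)).
under eq_bigr => l _ do rewrite correlation //.
rewrite !big_split /= prod_dig_eq prodr_const card_ord mulrC.
rewrite -!mulrA; congr (_ * (_ * (_ * _))).
by apply: eq_bigr => l _; rewrite (tnth_nth false).
Qed.

Lemma product_code_decode (f : k.+1.-tuple bool -> bool) (s : 'I_n -> bool) (z : T -> R)
    (e D theta : R) :
  D = signed_slice R f true - signed_slice R f false -> D != 0 ->
  theta = D * (signed_slice R f true + signed_slice R f false) / 2 ^+ k.+1 ->
  (forall t, `|z t - \sum_i (f [tuple of rcons (code_row i t) (s i)])%:R| <= e) ->
  (#|[set i | s i != (0 < \sum_t (D * (weight i t * z t) - theta))]%SET|)%:R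
    <= 4 ^+ k.+1 / D ^+ 2 * e ^+ 2.
Proof.
move=> DE D_neq0 thetaE err.
pose eta t := z t - \sum_i (f [tuple of rcons (code_row i t) (s i)])%:R.
pose er i := \sum_t weight i t * eta t.
have m_gt0R : 0 < m%:R :> R by rewrite ltr0n.
have mk_gt0 : 0 < m%:R ^+ k :> R by rewrite exprn_gt0.
have valE i : \sum_t (D * (weight i t * z t) - theta) =
    D * er i + (if s i then 1 else -1) * (m%:R ^+ k * D ^+ 2 / 2).
  rewrite sumrB sumr_const card_tuple card_ord -mulr_sumr.
  have -> : \sum_t weight i t * z t = er i + m%:R ^+ k * signed_slice R f (s i).
    transitivity (er i + \sum_t \sum_i' weight i t *
       (f [tuple of rcons (code_row i' t) (s i')])%:R).
      rewrite -big_split /=; apply: eq_bigr => t _.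
      by rewrite -mulr_sumr -mulrDr subrK.
    congr (_ + _); rewrite exchange_big /= (bigD1 i) //= weight_row eqxx mulr1.
    rewrite big1 ?addr0 // => i' ne_i'.
    by rewrite weight_row eq_sym (negPf ne_i') mulr0 mul0r.
  rewrite -[theta *+ _]mulr_natr natrX natrD thetaE.
  have -> : m%:R + m%:R = 2 * m%:R :> R by ring.
  rewrite exprMn exprS DE.
  have : 2 ^+ k != 0 :> R by rewrite expf_neq0.
  by case: (s i) => ?; field.
have sum_er : \sum_i er i ^+ 2 <= (2 * m%:R) ^+ k * ((2 * m%:R) ^+ k * e ^+ 2).
  apply: le_trans (bessel eta _ weight_ortho) _; first by rewrite exprn_gt0 // mulr_gt0.
  rewrite ler_pM2l ?exprn_gt0 ?mulr_gt0 //.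
  apply: (@le_trans _ _ (\sum_(t : T) e ^+ 2)).
    apply: ler_sum => t _; rewrite -[eta t ^+ 2]real_normK ?num_real //.
    by rewrite ler_sqr ?nnegrE ?err // (le_trans _ (err t)).
  rewrite sumr_const card_tuple card_ord -[_ *+ _]mulr_natl natrX natrD.
  by have -> : m%:R + m%:R = 2 * m%:R :> R by ring.
have wrong i : s i != (0 < \sum_t (D * (weight i t * z t) - theta)) ->
    m%:R ^+ k ^+ 2 * D ^+ 2 / 4 <= er i ^+ 2.
  rewrite valE => bad.
  have D2_gt0 : 0 < D ^+ 2 by rewrite exprn_even_gt0 //= D_neq0.
  pose c : R := m%:R ^+ k * D ^+ 2 / 2.
  have c_gt0 : 0 < c by rewrite divr_gt0 // mulr_gt0.
  have : c ^+ 2 <= (D * er i) ^+ 2.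
    move: bad; rewrite -/c; case: (s i); rewrite ?mul1r ?mulN1r.
      by rewrite /= eq_sym eqb_id -leNgt => ?; nra.
    by rewrite eq_sym eqbF_neg negbK => ?; nra.
  rewrite [(D * _) ^+ 2]exprMn /c => H; rewrite -(ler_pM2l D2_gt0); apply: (le_trans _ H).
  by rewrite le_eqVlt; apply/orP; left; apply/eqP; field.
pose B := [set i | s i != (0 < \sum_t (D * (weight i t * z t) - theta))]%SET.
rewrite -/B.
have D2_gt0 : 0 < D ^+ 2 by rewrite exprn_even_gt0 //= D_neq0.
have : (#|B|)%:R * (m%:R ^+ k ^+ 2 * D ^+ 2 / 4) <=
   (2 * m%:R) ^+ k * ((2 * m%:R) ^+ k * e ^+ 2).
  apply: le_trans sum_er; rewrite mulr_natl -sumr_const.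
  rewrite [X in _ <= X](bigID (mem B)) /= -[X in X <= _]addr0 lerD //.
    by apply: ler_sum => i; rewrite inE => /wrong.
  by apply: sumr_ge0 => i _; apply: sqr_ge0.
rewrite -ler_pdivlMr; last by rewrite divr_gt0 // mulr_gt0 // exprn_gt0.
move/le_trans; apply; rewrite !exprMn [4 ^+ k.+1]exprS.
have -> : 4 = 2 * 2 :> R by ring.
rewrite exprMn le_eqVlt; apply/orP; left; apply/eqP; field.
by rewrite D_neq0 /= expf_neq0 // gt_eqF.
Qed.

End ProductCode.

(** * Total correctness with time bounds *)

Section Machine.
Variable R : realType.
Implicit Types (st : state R) (p : program) (T B : nat) (Q : state R -> Prop).

Definition runs p st T Q : Prop :=
  exists t st', [/\ exec p st t st', (t <= T)%N & Q st'].

Lemma runs_weaken p st T T' Q Q' :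
  runs p st T Q -> (T <= T')%N -> (forall st', Q st' -> Q' st') ->
  runs p st T' Q'.
Proof.
move=> [t [st' [ex le_t q]]] le_T QQ'.
by exists t, st'; split=> //; [apply: leq_trans le_T|apply: QQ'].
Qed.

Lemma runs_iset v e st Q :
  Q (set_reg st v (ieval st e)) -> runs (ISet v e) st (icost e).+1 Q.
Proof. by move=> q; do 2 eexists; split; [exact: exec_iset| |]. Qed.

Lemma runs_rset a i e st Q :
  Q (Defs.set_mem st a (ieval st i) (reval st e)) ->
  runs (RSet a i e) st (icost i + rcost e).+1 Q.
Proof. by move=> q; do 2 eexists; split; [exact: exec_rset| |]. Qed.

Lemma runs_seq p1 p2 st T1 T2 Q1 Q :
  runs p1 st T1 Q1 -> (forall st1, Q1 st1 -> runs p2 st1 T2 Q) ->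
  runs (Seq p1 p2) st (T1 + T2).+1 Q.
Proof.
move=> [t1 [st1 [ex1 le1 q1]]] /(_ st1 q1) [t2 [st2 [ex2 le2 q2]]].
exists (t1 + t2).+1, st2; split=> //; first exact: exec_seq ex1 ex2.
by rewrite ltnS leq_add.
Qed.

Lemma runs_if b p1 p2 st T Q :
  (teval st b -> runs p1 st T Q) -> (~~ teval st b -> runs p2 st T Q) ->
  runs (If b p1 p2) st (tcost b + T).+1 Q.
Proof.
move=> H1 H2; case: (boolP (teval st b)) => tb.
  have [t [st' [ex le_t q]]] := H1 tb.
  by do 2 eexists; split; [exact: exec_if_true ex|rewrite ltnS leq_add2l|].
have [t [st' [ex le_t q]]] := H2 tb.
by do 2 eexists; split; [exact: exec_if_false ex|rewrite ltnS leq_add2l|].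
Qed.

Lemma runs_while (b : test) p N (Inv : nat -> state R -> Prop) st B :
  Inv 0%N st ->
  (forall j st', (j < N)%N -> Inv j st' ->
     teval st' b /\ runs p st' B (Inv j.+1)) ->
  (forall st', Inv N st' -> ~~ teval st' b) ->
  runs (While b p) st (N.+1 * (tcost b + B).+1) (Inv N).
Proof.
move=> Inv0 step stop.
suff H : forall M j st', (j + M)%N = N -> Inv j st' ->
    runs (While b p) st' (M.+1 * (tcost b + B).+1) (Inv N) by exact: H Inv0.
elim=> [|M IH] j st'.
  rewrite addn0 => -> invN; exists (tcost b).+1, st'; split=> //.
  - by apply: exec_while_false; apply: stop.
  - by rewrite mul1n ltnS leq_addr.
move=> eqN invj; have lt_jN : (j < N)%N by lia.
have [tb [t1 [st1 [ex1 le1 inv1]]]] := step _ _ lt_jN invj.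
have [|t2 [st2 [ex2 le2 inv2]]] := IH j.+1 st1 _ inv1; first lia.
exists (tcost b + t1 + t2).+1, st2; split=> //; first exact: exec_while_true ex1 ex2.
by rewrite mulSn; lia.
Qed.

Definition For v e p : program :=
  Seq (ISet v (IConst 0))
    (While (ILt (IReg v) e) (Seq p (ISet v (IAdd (IReg v) (IConst 1))))).

Lemma runs_for v e p N (Inv : nat -> state R -> Prop) st B :
  Inv 0%N (set_reg st v 0) ->
  (forall j st', Inv j st' -> ieval st' e = N) ->
  (forall j st', (j < N)%N -> Inv j st' -> ireg st' v = j ->
     runs p st' B (fun st2 => ireg st2 v = j /\ Inv j.+1 (set_reg st2 v j.+1))) ->
  runs (For v e p) st (3 + N.+1 * (icost e + B + 8)) (Inv N).
Proof.
move=> Inv0 evale step.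
have W : forall st1, ireg st1 v = 0%N /\ Inv 0%N st1 ->
    runs (While (ILt (IReg v) e) (Seq p (ISet v (IAdd (IReg v) (IConst 1)))))
      st1 (N.+1 * (icost e + B + 8)) (Inv N).
  move=> st1 inv1.
  apply: (@runs_weaken _ _ (N.+1 * (tcost (ILt (IReg v) e) + (B + 4).+1).+1)%N _
    (fun st => ireg st v = N /\ Inv N st)) => [| |st' []//].
  - apply: (@runs_while _ _ _ (fun j st => ireg st v = j /\ Inv j st)) => //
      [j st' lt_j [ej invj]|st' [eN invN]].
    + split; first by rewrite /= ej (evale _ _ invj).
      apply: runs_seq (step _ _ lt_j invj ej) _ => st2 [e2 inv2].
      by apply: runs_iset; rewrite /= e2 addn1 /= eqxx.
    + by rewrite /= eN (evale _ _ invN) ltnn.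
  - by rewrite leq_mul2l /=; lia.
apply: runs_weaken (runs_seq (Q1 := fun st1 => ireg st1 v = 0%N /\ Inv 0%N st1)
  (runs_iset _) W) _ _ => //=; first by rewrite eqxx.
Qed.

End Machine.

(** * The decoding program *)

Definition column (L : nat) (t : nat -> nat) (l : nat) : nat := (l * L + t l)%N.

Fixpoint query_code (d L : nat) (t : nat -> nat) (r : nat) : nat :=
  if r is r'.+1 then (query_code d L t r' * d + column L t r')%N else 0%N.

Section Decoder.
Variables (R : realType) (k d n : nat) (mem0 mem1 : nat -> R) (sc D theta : R).

Definition decoder_term (L i : nat) (t : nat -> nat) : R :=
  D * ((\prod_(l < k) (1 - 2 * mem0 (i * d + column L t l)%N)) *
       (sc * mem1 (query_code d L t k))) - theta.

Definition decoder_sum (L i : nat) : R :=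
  \sum_(t : k.-tuple 'I_L) decoder_term L i (nth 0%N [seq val b | b <- t]).

Definition upd (t : nat -> nat) (r b : nat) : nat -> nat :=
  fun l => if l == r then b else t l.

Fixpoint nested_sum (L i r : nat) (t : nat -> nat) : R :=
  if r is r'.+1 then \sum_(b < L) nested_sum L i r' (upd t r' b)
  else decoder_term L i t.

Lemma query_code_ext L t t' r :
  (forall l, (l < r)%N -> t l = t' l) -> query_code d L t r = query_code d L t' r.
Proof.
elim: r => //= r IH tt'; rewrite IH ?/column ?tt' // => l lt_l.
by rewrite tt' // ltnS ltnW.
Qed.

Lemma decoder_term_ext L i t t' :
  (forall l, (l < k)%N -> t l = t' l) -> decoder_term L i t = decoder_term L i t'.
Proof.
move=> tt'; rewrite /decoder_term (query_code_ext _ tt').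
by congr (D * (_ * _) - _); apply: eq_bigr => l _; rewrite /column tt'.
Qed.

Lemma nested_sum_ext L i r t t' :
  (forall l, (r <= l)%N -> t l = t' l) -> nested_sum L i r t = nested_sum L i r t'.
Proof.
elim: r t t' => [|r IH] t t' tt' /=.
  by apply: decoder_term_ext => l _; apply: tt'.
apply: eq_bigr => b _; apply: IH => l le_l; rewrite /upd.
by case: eqP => // /eqP ne_l; apply: tt'; rewrite ltn_neqAle eq_sym ne_l.
Qed.

Lemma nested_sumE L i r t :
  nested_sum L i r t = \sum_(u : r.-tuple 'I_L)
    decoder_term L i
      (fun l => if (l < r)%N then nth 0%N [seq val b | b <- u] l else t l).
Proof.
elim: r t => [|r IH] t /=.
  rewrite (bigD1 [tuple]) //= big1 ?addr0 // => u /eqP [].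
  by rewrite [u]tuple0.
rewrite big_tuple_rcons; apply: eq_bigr => b _; rewrite IH.
apply: eq_bigr => u _; apply: decoder_term_ext => l _ /=.
rewrite map_rcons nth_rcons size_map size_tuple ltnS /upd.
by case: (ltngtP l r).
Qed.

Lemma nested_sum_full L i t : nested_sum L i k t = decoder_sum L i.
Proof.
rewrite nested_sumE; apply: eq_bigr => u _.
by apply: decoder_term_ext => l ->.
Qed.

End Decoder.

Definition column_expr (l : nat) : iexpr :=
  IAdd (IMul (IConst l) (IReg 4)) (IReg l.+1.+4).

Fixpoint code_expr (r : nat) : iexpr :=
  if r is r'.+1 then IAdd (IMul (code_expr r') (IReg 1)) (column_expr r')
  else IConst 0.

Definition entry_expr (l : nat) : rexpr :=
  RGet 0 (IAdd (IMul (IReg 2) (IReg 1)) (column_expr l)).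

Fixpoint weight_expr (r : nat) : rexpr :=
  if r is r'.+1 then
    RMul (weight_expr r') (RSub ROne (RAdd (entry_expr r') (entry_expr r')))
  else ROne.

Fixpoint pow_expr (r : nat) : iexpr :=
  if r is r'.+1 then IMul (IReg 3) (pow_expr r') else IConst 1.

Section Program.
Variables (k : nat) (esc eD eth : rexpr).

Definition add_term : program :=
  RSet 3 (IConst 0) (RAdd (RGet 3 (IConst 0))
    (RSub (RMul eD (RMul (weight_expr k) (RMul esc (RGet 1 (code_expr k))))) eth)).

Fixpoint nested_loops (r : nat) : program :=
  if r is r'.+1 then For r'.+1.+4 (IReg 4) (nested_loops r') else add_term.

Definition decode_bit : program :=
  Seq (RSet 3 (IConst 0) RZero)
    (Seq (nested_loops k)
       (If (RLt RZero (RGet 3 (IConst 0)))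
          (RSet 2 (IReg 2) ROne) (RSet 2 (IReg 2) RZero))).

(* Registers: 2 is the row i, 3 is m, 4 is L = 2m, 5 + l is the l-th digit.
   Bank 3: cell 0 is the running sum, cell 1 is n as a real. *)
Definition decoder : program :=
  Seq (For 2 (IReg 0) (RSet 3 (IConst 1) (RAdd (RGet 3 (IConst 1)) ROne)))
 (Seq (ISet 3 (IConst 1))
 (Seq (While (ILt (pow_expr k) (IReg 0)) (ISet 3 (IAdd (IReg 3) (IReg 3))))
 (Seq (ISet 4 (IAdd (IReg 3) (IReg 3)))
      (For 2 (IReg 0) decode_bit)))).

Fixpoint nested_cost (r : nat) : nat :=
  if r is r'.+1 then (3 + 2 * (nested_cost r' + 9))%N
  else (1 + rcost (RAdd (RGet 3 (IConst 0))
    (RSub (RMul eD (RMul (weight_expr k) (RMul esc (RGet 1 (code_expr k))))) eth))).+1.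

Section Correctness.
Variables (R : realType) (n d : nat) (mem0 mem1 : nat -> R) (sc D theta : R).
Hypothesis eDE : forall st : state R, reval st eD = D.
Hypothesis ethE : forall st : state R, reval st eth = theta.
Hypothesis escE : forall st : state R, rmem st 3 1 = n%:R -> reval st esc = sc.

Definition inputs (st : state R) : Prop :=
  [/\ ireg st 0 = n, ireg st 1 = d, rmem st 0 = mem0 & rmem st 1 = mem1].

Definition env (i L : nat) (st : state R) : Prop :=
  [/\ inputs st, ireg st 2 = i, ireg st 4 = L & rmem st 3 1 = n%:R].

Definition digit (st : state R) (l : nat) : nat := ireg st l.+1.+4.

Lemma code_exprE i L st r : env i L st ->
  ieval st (code_expr r) = query_code d L (digit st) r.
Proof.
move=> e; elim: r => //= r ->; case: (e) => -[_ -> _ _] _ /= -> _.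
by [].
Qed.

Lemma weight_exprE i L st r : env i L st ->
  reval st (weight_expr r) =
  \prod_(l < r) (1 - 2 * mem0 (i * d + column L (digit st) l)%N).
Proof.
move=> e; elim: r => [|r IH]; first by rewrite big_ord0.
rewrite big_ord_recr /= IH; congr (_ * (1 - _)).
by case: (e) => -[_ -> -> _] -> -> _; rewrite mulr_natl mulr2n.
Qed.

Lemma pow_exprE (st : state R) r : ieval st (pow_expr r) = (ireg st 3 ^ r)%N.
Proof. by elim: r => //= r ->; rewrite expnS. Qed.

Lemma runs_nested i L r st : (0 < L)%N -> env i L st ->
  runs (nested_loops r) st (nested_cost r * L ^ r) (fun st' =>
    [/\ env i L st', rmem st' 2 = rmem st 2,
        rmem st' 3 0 = rmem st 3 0 +
          nested_sum k d mem0 mem1 sc D theta L i r (digit st) &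
        forall l, (r <= l)%N -> digit st' l = digit st l]).
Proof.
move=> L_gt0; elim: r st => [|r IH] st est.
  rewrite expn0 muln1; apply: runs_rset; split=> //.
  rewrite /= /decoder_term eDE ethE escE; last by case: est.
  rewrite (weight_exprE k est) (code_exprE k est).
  by case: est => -[_ _ _ ->].
pose Inv j st' := [/\ env i L st', rmem st' 2 = rmem st 2,
  rmem st' 3 0 = rmem st 3 0 + \sum_(b < j)
    nested_sum k d mem0 mem1 sc D theta L i r (upd (digit st) r b) &
  forall l, (r < l)%N -> digit st' l = digit st l].
apply: (@runs_weaken _ _ _
  (3 + L.+1 * (icost (IReg 4) + nested_cost r * L ^ r + 8))%N _ (Inv L)).
- apply: runs_for.
  + split=> //; first by rewrite big_ord0 addr0.
    by move=> l lt_l; rewrite /digit /= !eqSS gtn_eqF.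
  + by move=> j st' [[_ _ ? _]].
  + move=> j st' lt_j [ej mem2 S_j digs] reg_j.
    apply: runs_weaken (IH st' ej) _ _ => // st2 [e2 mem2' S2 digs2].
    split; first by have := digs2 r (leqnn r); rewrite /digit => ->.
    split=> //.
    * by rewrite /= mem2'.
    * rewrite big_ord_recr addrA -S_j /= S2; congr (_ + _).
      apply: nested_sum_ext => l le_l; rewrite /upd.
      case: eqP => [->//|/eqP ne_l]; apply: digs.
      by rewrite ltn_neqAle eq_sym ne_l.
    * move=> l lt_l; rewrite /digit /= !eqSS gtn_eqF //.
      by rewrite -/(digit st2 l) digs2 ?digs // ltnW.
- rewrite expnSr /=; have := expn_gt0 L r; rewrite L_gt0 /= => Lr_gt0.
  by set X := (L ^ r)%N in Lr_gt0 *; nia.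
- by move=> st' [].
Qed.

Definition decode_cost (L : nat) : nat := (nested_cost k * L ^ k + 15)%N.

Lemma runs_decode_bit i L st : (0 < L)%N -> env i L st ->
  runs decode_bit st (decode_cost L) (fun st' => env i L st' /\
    forall j, rmem st' 2 j =
      if j == i then ((0 : R) < decoder_sum k d mem0 mem1 sc D theta L i)%R%:R
      else rmem st 2 j).
Proof.
move=> L_gt0 est.
apply: (@runs_weaken _ _ _ (3 +
   (nested_cost k * L ^ k + (5 + 4).+1).+1).+1 _ _ _ _ _ (fun _ H => H)); last first.
  by rewrite /decode_cost; lia.
apply: (@runs_seq _ _ _ _ _ _ (fun st1 => [/\ env i L st1, rmem st1 2 = rmem st 2 &
   rmem st1 3 0 = 0])).
  by apply: runs_rset; split.
move=> st1 [e1 mem2 S0].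
apply: (@runs_seq _ _ _ _ _ _ _ _ (runs_nested _ L_gt0 e1)).
move=> st2 [e2 mem2' S2 _].
have S2E : rmem st2 3 0 = decoder_sum k d mem0 mem1 sc D theta L i.
  by rewrite S2 S0 add0r nested_sum_full.
have reg2 : ireg st2 2 = i by case: e2.
apply: (@runs_weaken _ _ _ (tcost (RLt RZero (RGet 3 (IConst 0))) + 3).+1 _ _ _ _ _
  (fun _ H => H)) => //.
by apply: runs_if => /= test; apply: runs_rset; (split; first by []) => j /=;
  rewrite reg2 -S2E; case: eqP => // _;
  rewrite ?test ?(negPf test) // mem2' mem2.
Qed.

End Correctness.
End Program.

Definition half_block (k n : nat) : nat := (2 ^ up_log (2 ^ k) n)%N.

Lemma half_block_gt0 k n : (0 < half_block k n)%N.
Proof. by rewrite expn_gt0. Qed.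

Lemma exp2_gt1 k : (0 < k)%N -> (1 < 2 ^ k)%N.
Proof. by move=> k_gt0; rewrite -[1%N](expn0 2) ltn_exp2l. Qed.

Lemma half_block_ge k n : (0 < k)%N -> (n <= half_block k n ^ k)%N.
Proof.
by move=> k_gt0; rewrite -expnM mulnC expnM up_logP // exp2_gt1.
Qed.

Lemma half_block_le k n : (0 < k)%N -> (0 < n)%N ->
  (half_block k n ^ k <= 2 ^ k * n)%N.
Proof.
move=> k_gt0 n_gt0; rewrite -expnM mulnC expnM; have p_gt1 := exp2_gt1 k_gt0.
have [n_le1|n_gt1] := leqP n 1.
  have -> : n = 1%N by lia.
  by rewrite up_log1 expn0 muln1 ltnW.
have := up_log_gtn p_gt1 n_gt1; have : (0 < up_log (2 ^ k) n)%N by rewrite up_log_gt0 p_gt1.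
case: (up_log _ _) => // r _ /= lt_n; rewrite expnS leq_mul2l ltnW ?orbT //.
Qed.

Definition scale_expr (scaled : bool) : rexpr :=
  if scaled then RGet 3 (IConst 1) else ROne.

Definition scale (R : realType) (scaled : bool) (n : nat) : R :=
  if scaled then n%:R else 1.

Section FullProgram.
Variables (R : realType) (k : nat) (scaled : bool) (eD eth : rexpr) (D theta : R).
Hypothesis k_gt0 : (0 < k)%N.
Hypothesis eDE : forall st : state R, reval st eD = D.
Hypothesis ethE : forall st : state R, reval st eth = theta.

Let prog := decoder k (scale_expr scaled) eD eth.

Lemma runs_decoder (n d : nat) (st : state R) :
  (0 < n)%N -> ireg st 0 = n -> ireg st 1 = d -> rmem st 3 1 = 0 ->
  let L := (half_block k n + half_block k n)%N in
  runs prog st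
    (200 + 20 * n + n.+1 * (icost (pow_expr k) + 30) +
       n.+1 * (decode_cost k (scale_expr scaled) eD eth L + 9))
    (fun st' => forall i, (i < n)%N -> rmem st' 2 i =
      ((0 : R) < decoder_sum k d (rmem st 0) (rmem st 1) (scale R scaled n)
               D theta L i)%R%:R).
Proof.
move=> n_gt0 reg0 reg1 cell0 L; rewrite /prog /decoder.
pose inp := inputs n d (rmem st 0) (rmem st 1).
set T1 := (3 + n.+1 * (icost (IReg 0) + 6 + 8))%N.
set T3 := ((up_log (2 ^ k) n).+1 *
  (tcost (ILt (pow_expr k) (IReg 0)) + (icost (IAdd (IReg 3) (IReg 3))).+1).+1)%N.
set T5 := (3 + n.+1 * (icost (IReg 0) +
   decode_cost k (scale_expr scaled) eD eth L + 8))%N.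
apply: (@runs_weaken _ _ _ (T1 + (2 + (T3 + (4 + T5).+1).+1).+1).+1 _ _ _ _ _
  (fun _ H => H)); last first.
  have le_r : (up_log (2 ^ k) n <= n)%N.
    by rewrite up_log_min ?exp2_gt1 // ltnW // ltn_expl // exp2_gt1.
  by rewrite /T1 /T3 /T5 /=; nia.
apply: (@runs_seq _ _ _ _ _ _ (fun st1 => inp st1 /\ rmem st1 3 1 = n%:R)).
  apply: (@runs_for _ _ _ _ n (fun j st1 => inp st1 /\ rmem st1 3 1 = j%:R) st 6).
  - by split.
  - by move=> j st' [[]].
  - move=> j st' lt_j [inp' cell] reg2; apply: (@runs_rset _ 3 (IConst 1)
      (RAdd (RGet 3 (IConst 1)) ROne)).
    by split=> //; split=> //=; rewrite cell natr1.
move=> st1 [inp1 cell1].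
apply: (@runs_seq _ _ _ _ _ _ (fun st2 => [/\ inp st2, rmem st2 3 1 = n%:R &
    ireg st2 3 = 1%N])).
  by apply: runs_iset; split=> //=; case: inp1.
move=> st2 H2.
pose Inv j (st' : state R) := [/\ inp st', rmem st' 3 1 = n%:R & ireg st' 3 = (2 ^ j)%N].
have loop : runs (While (ILt (pow_expr k) (IReg 0)) (ISet 3 (IAdd (IReg 3) (IReg 3))))
    st2 T3 (Inv (up_log (2 ^ k) n)).
  have powE j st' : Inv j st' ->
      teval st' (ILt (pow_expr k) (IReg 0)) = ((2 ^ k) ^ j < n)%N.
    by case=> -[r0 _ _ _] _ r3; rewrite /= pow_exprE r0 r3 -!expnM mulnC.
  apply: runs_while => //.
  - move=> j st' lt_j inv; split.
      rewrite (powE j) // ltnNge; apply/negP => /(up_log_min (exp2_gt1 k_gt0)).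
      by rewrite leqNgt lt_j.
    apply: runs_iset; case: inv => -[r0 r1 m0 m1] cell r3.
    by split=> //=; rewrite r3 addnn -mul2n expnS.
  - by move=> st' /powE ->; rewrite -leqNgt up_logP // exp2_gt1.
apply: (@runs_seq _ _ _ _ _ _ _ _ loop) => st3 [inp3 cell3 reg3].
apply: (@runs_seq _ _ _ _ _ _ (fun st4 => [/\ inp st4, rmem st4 3 1 = n%:R &
    ireg st4 4 = L])).
  by apply: runs_iset; split=> //=; rewrite ?reg3 //; case: inp3.
move=> st4 [inp4 cell4 reg4].
have L_gt0 : (0 < L)%N by rewrite addn_gt0 half_block_gt0.
pose bit i : R := ((0 : R) < decoder_sum k d (rmem st 0) (rmem st 1)
   (scale R scaled n) D theta L i)%R%:R.
pose Out j (st' : state R) := [/\ inp st', rmem st' 3 1 = n%:R, ireg st' 4 = L &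
  forall i, (i < j)%N -> rmem st' 2 i = bit i].
apply: (@runs_weaken _ _ _ T5 _ (Out n)) => [|//|st' []//].
apply: runs_for.
- by split.
- by move=> j st' [[]].
- move=> j st' lt_j [inp' cell' reg' out] reg2.
  have escE : forall st0 : state R, rmem st0 3 1 = n%:R ->
      reval st0 (scale_expr scaled) = scale R scaled n.
    by move=> st0; rewrite /scale_expr /scale; case: scaled.
  have env' : env n d (rmem st 0) (rmem st 1) j L st' by split.
  apply: (runs_weaken (runs_decode_bit k eDE ethE escE L_gt0 env') (leqnn _)).
  move=> st5 [[inp5 reg25 reg45 cell5] out5]; split=> //; split=> //.
  move=> i; rewrite ltnS /= out5; case: eqP => [->//|/eqP ne_i le_i].
  by apply: out; rewrite ltn_neqAle ne_i.
Qed.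

End FullProgram.

Definition code_attack (R : realType) (k : nat) (scaled : bool) (D theta : R)
    (n d : nat) : attack R n d k := fun U y =>
  let st := initial_state U y in
  [tuple 0 < decoder_sum k d (rmem st 0) (rmem st 1) (scale R scaled n) D theta
     (half_block k n + half_block k n) i | i < n].

Definition constant_expr (R : realType) (x : R) : Prop :=
  exists e, forall st : state R, reval st e = x.

Lemma code_attack_computed (R : realType) (k : nat) (scaled : bool) (D theta : R) :
  (0 < k)%N -> constant_expr D -> constant_expr theta ->
  exists (p : program) (C : nat), forall n d : nat, (0 < n)%N -> (0 < d)%N ->
    computes_within p (@code_attack R k scaled D theta n d) (C * (d ^ k * n ^ 2)).
Proof.
move=> k_gt0 [eD eDE] [eth ethE].
exists (decoder k (scale_expr scaled) eD eth).
pose K := nested_cost k (scale_expr scaled) eD eth k.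
exists (220 + 2 * (icost (pow_expr k) + 30) + 2 * (K * 4 ^ k + 24))%N.
move=> n d n_gt0 d_gt0 U y.
have [] := runs_decoder scaled k_gt0 eDE ethE (n := n) (d := d)
  (st := initial_state U y) n_gt0 => // t [st' [ex le_t out]].
exists t, st'; split=> //; last by move=> i; rewrite out // tnth_mktuple.
apply: leq_trans le_t _; rewrite /decode_cost -/K.
have : ((half_block k n + half_block k n) ^ k <= 4 ^ k * n)%N.
  rewrite addnn -mul2n expnMn (_ : 4 = 2 * 2)%N // expnMn -mulnA leq_mul2l.
  by rewrite half_block_le ?orbT.
have : (0 < d ^ k)%N by rewrite expn_gt0 d_gt0.
move: (icost _) ((_ + _) ^ k)%N (d ^ k)%N (4 ^ k)%N => c X Y Z Y_gt0 le_X.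
apply: (@leq_trans ((220 + 2 * (c + 30) + 2 * (K * Z + 24)) * n ^ 2)); last first.
  by rewrite leq_mul2l leq_pmull // orbT.
have le_KX : (K * X <= K * (Z * n))%N by rewrite leq_mul2l le_X orbT.
rewrite mulnA in le_KX; move: (K * X)%N (K * Z)%N le_KX => A B le_A.
by rewrite -mulnn; nia.
Qed.

(** * Reconstruction *)

Lemma mem0_initial (R : realType) (n d k : nat) (U : 'M[bool]_(n, d))
    (y : k.-tuple 'I_d -> R) (i : 'I_n) (j : 'I_d) :
  rmem (initial_state U y) 0 (i * d + j)%N = (U i j)%:R.
Proof.
have d_gt0 : (0 < d)%N by case: (j) => j' /(leq_ltn_trans (leq0n j')).
have codeE (i' : 'I_n) (j' : 'I_d) :
    (i' * d + j' == i * d + j)%N = (i' == i) && (j' == j).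
  apply/eqP/andP => [eq_code|[/eqP -> /eqP ->]//]; split; apply/eqP/val_inj => /=.
    by move/(congr1 (divn^~ d)): eq_code; rewrite !divnMDl // !divn_small // !addn0.
  by move/(congr1 (modn^~ d)): eq_code; rewrite !modnMDl !modn_small.
rewrite /= (bigD1 i) //= [X in _ + X]big1 ?addr0 => [|i' ne_i'].
  rewrite (eq_bigl (pred1 j)) ?big_pred1_eq // => j'.
  by rewrite codeE eqxx.
by rewrite big_pred0 // => j'; rewrite codeE (negPf ne_i').
Qed.

Lemma tuple_code_inj (d k : nat) : injective (@tuple_code d k).
Proof.
have foldl_inj (s s' : seq 'I_d) (a a' : nat) : size s = size s' ->
    foldl (fun a (j : 'I_d) => (a * d + j)%N) a s =
    foldl (fun a (j : 'I_d) => (a * d + j)%N) a' s' -> a = a' /\ s = s'.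
  elim: s s' a a' => [|x s IH] [|x' s'] a a' //= [] size_s /IH -/(_ size_s) [eq_a ->].
  have d_gt0 : (0 < d)%N by case: (x) => j' /(leq_ltn_trans (leq0n j')).
  split.
    by move/(congr1 (divn^~ d)): eq_a; rewrite !divnMDl // !divn_small // !addn0.
  congr (_ :: _); apply: val_inj => /=.
  by move/(congr1 (modn^~ d)): eq_a; rewrite !modnMDl !modn_small.
move=> J J' /foldl_inj []; first by rewrite !size_tuple.
by move=> _ /val_inj.
Qed.

Lemma mem1_initial (R : realType) (n d k : nat) (U : 'M[bool]_(n, d))
    (y : k.-tuple 'I_d -> R) (J : k.-tuple 'I_d) :
  rmem (initial_state U y) 1 (tuple_code J) = y J.
Proof.
rewrite /= (eq_bigl (pred1 J)) ?big_pred1_eq // => J'.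
exact: (inj_eq (@tuple_code_inj d k)).
Qed.

Lemma query_codeE (d L k : nat) (t : nat -> nat) (J : k.-tuple 'I_d) :
  (forall l : 'I_k, tnth J l = column L t l :> nat) ->
  query_code d L t k = tuple_code J.
Proof.
move=> JE.
have -> : query_code d L t k =
    foldl (fun a j => a * d + j)%N 0%N [seq column L t l | l <- iota 0 k].
  elim: k {J JE} => [//|k IH].
  by rewrite -[in RHS]addn1 iotaD map_cat foldl_cat add0n /= IH.
have -> : [seq column L t l | l <- iota 0 k] = [seq val j | j <- J].
  apply: (@eq_from_nth _ 0%N); rewrite !size_map size_iota ?size_tuple // => l lt_l.
  rewrite (nth_map 0%N) ?size_iota // nth_iota // add0n.
  have x0 := tnth J (Ordinal lt_l).
  by rewrite (nth_map x0) ?size_tuple // -(JE (Ordinal lt_l)) (tnth_nth x0).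
by rewrite /tuple_code; elim: (val J) 0%N => //= j s IH a; rewrite IH.
Qed.

Lemma reconstruct (R : realType) (k n d : nat) (f : k.+1.-tuple bool -> bool)
    (scaled : bool) (D theta : R) :
  (0 < k)%N ->
  D = signed_slice R f true - signed_slice R f false -> D != 0 ->
  theta = D * (signed_slice R f true + signed_slice R f false) / 2 ^+ k.+1 ->
  (k * (half_block k n + half_block k n) <= d)%N ->
  exists U : 'M[bool]_(n, d), forall (s : n.-tuple bool) (y : k.-tuple 'I_d -> R) (e : R),
    (forall J, `|scale R scaled n * y J - Sigma R f (U, s) J| <= e) ->
    (hamming s (code_attack scaled D theta U y))%:R <= 4 ^+ k.+1 / D ^+ 2 * e ^+ 2.
Proof.
move=> k_gt0 DE D_neq0 thetaE; set m := half_block k n; set L := (m + m)%N => le_d.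
have m_gt0 : (0 < m)%N := half_block_gt0 k n.
have L_gt0 : (0 < L)%N by rewrite addn_gt0 m_gt0.
have [h [balanced ortho]] := balanced_hadamard_exists R (up_log (2 ^ k) n).
have [dig [dig_lt dig_inj]] := digits_exist (half_block_ge n k_gt0).
exists (\matrix_(i, j) h (dig i (j %/ L)%N) (j %% L)%N) => s y e err.
set U := \matrix_(i, j) _ in err *.
have col_lt (t : k.-tuple 'I_L) (l : 'I_k) : (l * L + tnth t l < d)%N.
  apply: leq_trans le_d; apply: (@leq_trans (l.+1 * L)%N).
    by rewrite mulSn addnC ltn_add2r.
  by rewrite leq_mul2r ltn_ord orbT.
pose Jt t : k.-tuple 'I_d := [tuple Ordinal (col_lt t l) | l < k].
have UJ i t l : U i (tnth (Jt t) l) = h (dig i l) (tnth t l).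
  by rewrite mxE tnth_mktuple /= divnMDl // modnMDl divn_small // modn_small // addn0.
have SigmaE t : Sigma R f (U, s) (Jt t) =
    \sum_i (f [tuple of rcons (code_row (m := m) h dig i t) (tnth s i)])%:R.
  apply: eq_bigr => i _; rewrite /rowJ.
  suff -> : [tuple U i (tnth (Jt t) l) | l < k] = code_row (m := m) h dig i t by [].
  by apply: eq_from_tnth => l; rewrite !tnth_mktuple -UJ tnth_mktuple.
have := product_code_decode m_gt0 balanced ortho dig_lt dig_inj (s := tnth s)
  (z := fun t => scale R scaled n * y (Jt t)) DE D_neq0 thetaE
  (fun t => _ : `|_ - _| <= e).
move=> H; apply: le_trans (H _); last by move=> t; rewrite -SigmaE.
rewrite ler_nat subset_leq_card //; apply/fintype.subsetP => i; rewrite !inE.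
suff -> : tnth (code_attack scaled D theta U y) i = (0 < \sum_t
   (D * (weight (m := m) R h dig i t * (scale R scaled n * y (Jt t))) - theta)) by [].
rewrite tnth_mktuple; congr (0 < _); apply: eq_bigr => t _.
have nthE (l : 'I_k) : nth 0%N [seq val b | b <- t] l = tnth t l.
  have x0 := tnth t l.
  by rewrite (nth_map x0) ?size_tuple // (tnth_nth x0).
have codeE : query_code d L (nth 0%N [seq val b | b <- t]) k = tuple_code (Jt t).
  by apply: query_codeE => l; rewrite tnth_mktuple /column nthE.
rewrite /decoder_term codeE mem1_initial; congr (D * (_ * _) - _).
apply: eq_bigr => l _; rewrite /column nthE.
have := mem0_initial U y i (tnth (Jt t) l).
by rewrite UJ tnth_mktuple /= => ->; rewrite sgE.
Qed.

Lemma ilog_ge1 (R : realType) (q : nat) (x : R) : (0 < q)%N -> 1 <= ilog q x.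
Proof. by case: q => //= q _; rewrite /ilog /= /log1 le_max lexx orbT. Qed.

Lemma small_enough_fits (R : realType) (k q n d : nat) :
  (0 < k)%N -> (0 < q)%N -> (0 < n)%N ->
  small_enough k q (((4 * k) ^ k)%:R^-1 : R) n d ->
  (k * (half_block k n + half_block k n) <= d)%N.
Proof.
move=> k_gt0 q_gt0 n_gt0 small.
have kk_gt0 : (0 < (4 * k) ^ k)%N by rewrite expn_gt0 muln_gt0 k_gt0.
have le_nd : (n * (4 * k) ^ k <= d ^ k)%N.
  rewrite -(ler_nat R) natrM -ler_pdivlMr ?ltr0n //.
  apply: le_trans small _; rewrite [_ / ((4 * k) ^ k)%:R]mulrC.
  rewrite ler_pdivrMr; last exact: lt_le_trans (ilog_ge1 _ q_gt0).
  by rewrite ler_peMr ?ilog_ge1 // mulr_ge0 // invr_ge0 ler0n.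
rewrite -(leq_exp2r _ _ k_gt0); apply: leq_trans le_nd.
rewrite addnn -mul2n mulnA expnMn mulnC (_ : 4 * k = 2 * (k * 2))%N; last by lia.
rewrite [X in (_ <= _ * X)%N]expnMn mulnA leq_mul2r mulnC.
by rewrite [(n * _)%N]mulnC mulnC half_block_le ?orbT.
Qed.

(** * Randomized mechanisms *)

Lemma measurable_big_sum (disp : measure_display) (T : measurableType disp)
    (R : realType) (I : Type) (s : seq I) (P : pred I) (F : I -> T -> R) :
  (forall i, measurable_fun setT (F i)) ->
  measurable_fun setT (fun w => \sum_(i <- s | P i) F i w).
Proof.
move=> mF; elim: s => [|i s IH].
  by under eq_fun do rewrite big_nil; exact: measurable_cst.
under eq_fun do rewrite big_cons.
by case: (P i) => //; apply: measurable_funD.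
Qed.

Lemma measurable_hamming (disp : measure_display) (T : measurableType disp)
    (R : realType) (n : nat) (s : n.-tuple bool) (b : T -> n.-tuple bool) :
  (forall i, measurable_fun setT (fun w => tnth (b w) i)) ->
  measurable_fun setT (fun w => (hamming s (b w))%:R : R).
Proof.
move=> mb.
have hammingE w : (hamming s (b w))%:R =
    \sum_i (if tnth (b w) i then (~~ tnth s i)%:R else (tnth s i)%:R) :> R.
  rewrite /hamming -sum1_card natr_sum big_mkcond /=; apply: eq_bigr => i _.
  by rewrite inE; case: (tnth s i); case: (tnth (b w) i).
under eq_fun do rewrite hammingE.
apply: measurable_big_sum => i; apply: measurable_fun_ifT => //.
Qed.

Lemma measurable_code_attack (disp : measure_display) (T : measurableType disp)
    (R : realType) (k n d : nat) (scaled : bool) (D theta : R)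
    (U : 'M[bool]_(n, d)) (y : T -> k.-tuple 'I_d -> R) (i : 'I_n) :
  (forall J, measurable_fun setT (fun w => y w J)) ->
  measurable_fun setT (fun w => tnth (code_attack scaled D theta U (y w)) i).
Proof.
move=> my; under eq_fun do rewrite tnth_mktuple.
apply: measurable_fun_ltr; first exact: measurable_cst.
apply: measurable_big_sum => t; rewrite /decoder_term /=.
apply: measurable_funB; last exact: measurable_cst.
apply: measurable_funM; first exact: measurable_cst.
apply: measurable_funM; first exact: measurable_cst.
apply: measurable_funM; first exact: measurable_cst.
exact: measurable_big_sum.
Qed.

Section NonPrivate.
Local Open Scope classical_set_scope.
Local Open Scope ring_scope.
Variables (R : realType) (k q : nat) (f : k.+1.-tuple bool -> bool).
Variables (scaled : bool) (D theta : R).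
Hypotheses (k_gt0 : (0 < k)%N) (q_gt0 : (0 < q)%N).
Hypothesis DE : D = signed_slice R f true - signed_slice R f false.
Hypothesis D_neq0 : D != 0.
Hypothesis thetaE :
  theta = D * (signed_slice R f true + signed_slice R f false) / 2 ^+ k.+1.

Lemma code_attack_succeeds (n d : nat) (M : mechanism R n d k) (e : R) :
  (0 < n)%N -> small_enough k q (((4 * k) ^ k)%:R^-1 : R) n d ->
  (forall Db : database n d, {ae coins_law M, forall w, forall J,
     `|scale R scaled n * answer Db w J - Sigma R f Db J| <= e}) ->
  allows_reconstruction_by (@code_attack R k scaled D theta n d) M
    (4 ^+ k.+1 / D ^+ 2 * e ^+ 2) 0.
Proof.
move=> n_gt0 small noise.
have [U recU] := reconstruct scaled k_gt0 DE D_neq0 thetaE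
  (small_enough_fits k_gt0 q_gt0 n_gt0 small).
exists U => s success.
have m_success : measurable success.
  have := measurable_fun_ler
    (measurable_hamming (R := R) s (fun i => measurable_code_attack scaled D theta U i
      (measurable_answer (m := M) (U, s))))
    (measurable_cst (4 ^+ k.+1 / D ^+ 2 * e ^+ 2)).
  move=> /(_ measurableT [set true]%classic I); rewrite setTI.
  by congr measurable; apply/seteqP; split.
split=> //; rewrite subr0.
have null : coins_law M (~` success)%classic = 0.
  apply/(negligibleP (coins_law M)); first exact: measurableC.
  apply: negligibleS (noise (U, s)) => w /= nsucc ok; apply: nsucc.
  exact: recU ok.
have := probability_setC (coins_law M) (measurableC m_success).
by rewrite setCK null sube0 => ->.
Qed.

Lemma code_attack_non_private (d : nat -> nat)
    (M : forall n, mechanism R n (d n) k) (e : nat -> R) :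
  (forall n, small_enough k q (((4 * k) ^ k)%:R^-1 : R) n (d n)) ->
  e =o_\oo (fun n : nat => Num.sqrt (n%:R : R)) ->
  (forall n, (0 < n)%N -> forall Db : database n (d n),
     {ae coins_law (M n), forall w, forall J,
     `|scale R scaled n * answer Db w J - Sigma R f Db J| <= e n}) ->
  attribute_non_private_by (fun n => @code_attack R k scaled D theta n (d n)) M.
Proof.
move=> small e_o noise.
pose K : R := 4 ^+ k.+1 / D ^+ 2.
have D2_gt0 : 0 < D ^+ 2 by rewrite exprn_even_gt0 //= D_neq0.
have K_gt0 : 0 < K by rewrite divr_gt0 // exprn_gt0.
exists (fun n => K * e n ^+ 2), (fun=> 0); split.
- apply/eqoP => eps eps_gt0.
  have delta_gt0 : 0 < Num.sqrt (eps / K) by rewrite sqrtr_gt0 divr_gt0.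
  have /eqoP/(_ _ delta_gt0) := e_o; apply: filterS => n.
  rewrite normrM (gtr0_norm K_gt0) normrX => le_e.
  have : K * `|e n| ^+ 2 <= K * (Num.sqrt (eps / K) * `|Num.sqrt n%:R|) ^+ 2.
    by rewrite ler_pM2l // lerXn2r ?nnegrE ?mulr_ge0.
  move/le_trans; apply; rewrite exprMn real_normK ?num_real // !sqr_sqrtr //.
    by rewrite (ger0_norm (ler0n R n)) mulrA mulrCA divff ?gt_eqF // mulr1.
  by rewrite ltW // divr_gt0.
- apply/eqoP => eps eps_gt0; apply: nearW => n.
  by rewrite normr0 mulr_ge0 // ltW.
- apply: (@sub_infinite_set _ [set n | 0 < n]%N).
    by move=> n n_gt0; apply: code_attack_succeeds => //; apply: noise.
  have -> : [set n | 0 < n]%N%classic = ([set: nat] `\` [set 0%N])%classic.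
    apply/seteqP; split=> n /=; first by move=> n_gt0; split=> // n0; rewrite n0 in n_gt0.
    by move=> [_ n_neq0]; rewrite lt0n; apply/eqP.
  exact: infinite_setD infinite_nat (finite_set1 0%N).
Qed.
End NonPrivate.

Lemma constant_exprD (R : realType) (x y : R) :
  constant_expr x -> constant_expr y -> constant_expr (x + y).
Proof. by move=> [e ex] [e' ey]; exists (RAdd e e') => st /=; rewrite ex ey. Qed.

Lemma constant_exprB (R : realType) (x y : R) :
  constant_expr x -> constant_expr y -> constant_expr (x - y).
Proof. by move=> [e ex] [e' ey]; exists (RSub e e') => st /=; rewrite ex ey. Qed.

Lemma constant_exprM (R : realType) (x y : R) :
  constant_expr x -> constant_expr y -> constant_expr (x * y).
Proof. by move=> [e ex] [e' ey]; exists (RMul e e') => st /=; rewrite ex ey. Qed.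

Lemma constant_expr_div (R : realType) (x y : R) :
  constant_expr x -> constant_expr y -> constant_expr (x / y).
Proof. by move=> [e ex] [e' ey]; exists (RDiv e e') => st /=; rewrite ex ey. Qed.

Lemma constant_expr0 (R : realType) : constant_expr (0 : R).
Proof. by exists RZero. Qed.

Lemma constant_expr1 (R : realType) : constant_expr (1 : R).
Proof. by exists ROne. Qed.

Lemma constant_expr_signed_slice (R : realType) (k : nat)
    (f : k.+1.-tuple bool -> bool) (s : bool) :
  constant_expr (signed_slice R f s).
Proof.
apply: (big_ind (@constant_expr R)) => [||x _].
- exact: constant_expr0.
- exact: constant_exprD.
apply: constant_exprM; last first.
  by case: (f _); [exact: constant_expr1|exact: constant_expr0].
apply: (big_ind (@constant_expr R)) => [||l _].
- exact: constant_expr1.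
- exact: constant_exprM.
rewrite sgE; apply: constant_exprB; first exact: constant_expr1.
apply: constant_exprM.
  by apply: constant_exprD; exact: constant_expr1.
by case: (tnth x l); [exact: constant_expr1|exact: constant_expr0].
Qed.

Lemma constant_expr_exp2 (R : realType) (r : nat) : constant_expr (2 ^+ r : R).
Proof.
elim: r => [|r IH]; first by rewrite expr0; exact: constant_expr1.
rewrite exprS; apply: constant_exprM => //.
by apply: constant_exprD; exact: constant_expr1.
Qed.

Theorem theorem3p5 (R : realType) (k q : nat) (hk : (1 <= k)%N) (hq : (1 <= q)%N) :
  exists2 c : R, 0 < c &
  forall f : k.+1.-tuple bool -> bool, nondegenerate_fun R f ->
  (exists (p : program) (C : nat) (A : forall n d : nat, attack R n d k),
    (forall n d : nat, (0 < n)%N -> small_enough k q c n d ->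
       computes_within p (A n d) (C * (d ^ k * n ^ 2))) /\
    forall (d : nat -> nat) (M : forall n : nat, mechanism R n (d n) k),
      (forall n : nat, small_enough k q c n (d n)) ->
      releases_with_noise_o M
        (fun n D J => Sigma R f D J)
        (fun n : nat => Num.sqrt (n%:R : R)) ->
      attribute_non_private_by (fun n => A n (d n)) M)
  /\
  (exists (p : program) (C : nat) (A : forall n d : nat, attack R n d k),
    (forall n d : nat, (0 < n)%N -> small_enough k q c n d ->
       computes_within p (A n d) (C * (d ^ k * n ^ 2))) /\
    forall (d : nat -> nat) (M : forall n : nat, mechanism R n (d n) k),
      (forall n : nat, small_enough k q c n (d n)) ->
      releases_with_noise_o M
        (fun n D J => Sigma R f D J / n%:R)
        (fun n : nat => (Num.sqrt (n%:R : R))^-1) ->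
      attribute_non_private_by (fun n => A n (d n)) M).
Proof.
exists ((4 * k) ^ k)%:R^-1.
  by rewrite invr_gt0 ltr0n expn_gt0 muln_gt0 hk.
move=> f nondeg.
pose D := signed_slice R f true - signed_slice R f false.
pose theta := D * (signed_slice R f true + signed_slice R f false) / 2 ^+ k.+1.
have D_neq0 : D != 0 := signed_slice_neq nondeg.
have cD : constant_expr D by apply: constant_exprB; exact: constant_expr_signed_slice.
have ctheta : constant_expr theta.
  apply: constant_expr_div; last exact: constant_expr_exp2.
  by apply: constant_exprM => //; apply: constant_exprD;
     exact: constant_expr_signed_slice.
have d_gt0 n d : (0 < n)%N -> small_enough k q (((4 * k) ^ k)%:R^-1 : R) n d ->
    (0 < d)%N.
  move=> n_gt0 /(small_enough_fits hk hq n_gt0); apply: leq_trans.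
  by rewrite muln_gt0 hk addn_gt0 half_block_gt0.
split.
- have [p [C comp]] := code_attack_computed false hk cD ctheta.
  exists p, C, (code_attack false D theta); split=> [n d n_gt0 small|d M small].
    by apply: comp => //; exact: d_gt0 small.
  move=> [e e_o noise]; apply: (code_attack_non_private hk hq _ D_neq0 _ small e_o) => //.
  move=> n n_gt0 Db; apply: filterS (noise n Db) => w err J.
  by rewrite /scale mul1r.
- have [p [C comp]] := code_attack_computed true hk cD ctheta.
  exists p, C, (code_attack true D theta); split=> [n d n_gt0 small|d M small].
    by apply: comp => //; exact: d_gt0 small.
  move=> [e e_o noise].
  apply: (@code_attack_non_private _ _ _ _ _ _ _ hk hq _ D_neq0 _ _ _
    (fun n => n%:R * e n) small) => //.
    apply/eqoP => eps eps_gt0; have /eqoP/(_ _ eps_gt0) := e_o.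
    apply: filterS => n le_e; rewrite normrM ger0_norm //.
    apply: le_trans (ler_wpM2l (ler0n R n) le_e) _.
    rewrite mulrCA ler_pM2l // normfV ger0_norm ?sqrtr_ge0 //.
    have [->|n_gt0] := posnP n; first by rewrite mul0r.
    have sqrt_gt0 : 0 < Num.sqrt (n%:R : R) by rewrite sqrtr_gt0 ltr0n.
    by rewrite ler_pdivrMr // -expr2 sqr_sqrtr.
  move=> n n_gt0 Db; apply: filterS (noise n Db) => w err J.
  have n_gt0R : 0 < n%:R :> R by rewrite ltr0n.
  have -> : scale R true n * answer Db w J - Sigma R f Db J =
      n%:R * (answer Db w J - Sigma R f Db J / n%:R).
    by rewrite /scale mulrBr mulrCA divff ?mulr1 // gt_eqF.
  by rewrite normrM gtr0_norm // ler_pM2l.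
Qed.
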